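(* Let $\omega(p)=|\sin(p/2)|$, $v(p)=\omega'(p)$, and $\mathcal S(t)f(x,p)=f(x-v(p)t,p)$ for $x\in\mathbb R$, $p\in\mathbb T=\mathbb R/2\pi\mathbb Z$. Fix $1\le q\le r\le\infty$. Then for all $t\in\mathbb R$, $t\ne0$, $$\|\mathcal S(t)f\|_{L^r_xL^q_p}\le\Big|\frac t4\Big|^{-\left(\frac1q-\frac1r\right)}\,\|f\|_{L^q_xL^r_p\left(\omega(p)^{-\left(\frac1q-\frac1r\right)}\right)}.$$ Moreover, for $1\le q=r\le\infty$ and all $t\in\mathbb R$, $$\|\mathcal S(t)f\|_{L^r_xL^q_p}=\|f\|_{L^q_xL^r_p}.$$
   Context: Mixed norms: $\|f\|_{L^r_xL^q_p}=\big(\int_{\mathbb R}(\int_{\mathbb T}|f(x,p)|^q\,dp)^{r/q}dx\big)^{1/r}$, with the usual modification when an exponent is $\infty$. Weighted version: for a weight $W=W(p)\ge0$, $\|f\|_{L^r_xL^q_p(W)}=\|fW\|_{L^r_xL^q_p}$, i.e. the weight multiplies $f$ inside the norm. For $p\in(0,2\pi)$ one has $v(p)=\tfrac12\cos(p/2)$. *)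

(* Defs.v *)
From HB Require Import structures.
From mathcomp Require Import all_boot all_order all_algebra.
From mathcomp Require Import all_classical all_reals all_analysis.
From mathcomp Require Import complex.

Set Implicit Arguments.
Unset Strict Implicit.
Unset Printing Implicit Defensive.

Import Order.TTheory GRing.Theory Num.Theory.
Import numFieldNormedType.Exports.

Local Open Scope classical_set_scope.
Local Open Scope ring_scope.
Local Open Scope complex_scope.

(* A function on R x T, with T = R / 2 pi Z, is a function R -> R -> R[i] that
   is 2 pi-periodic in its second argument. *)
Definition periodic2 (R : realType) (f : R -> R -> R[i]) : Prop :=
  forall x p : R, f x (p + 2 * pi) = f x p.

(* The library's sigma-algebra on R is the Borel one; being almost everywhere
   equal to a Borel function is the same as being Lebesgue measurable. *)
Definition lebesgue_measurable2 (R : realType) (f : R -> R -> R[i]) : Prop :=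
  exists g : measurableTypeR R * measurableTypeR R -> R[i],
    [/\ measurable_fun setT (fun z => complex.Re (g z)),
        measurable_fun setT (fun z => complex.Im (g z)) &
        {ae (@lebesgue_measure R \x @lebesgue_measure R)%E,
           forall z, f z.1 z.2 = g z}].

(* Integration over T (total mass 2 pi) is integration over [0, 2 pi[. *)
Definition torus_measure (R : realType) : {measure set (measurableTypeR R) -> \bar R} :=
  mrestr (@lebesgue_measure R) (measurable_itv `[(0 : R), 2 * pi[).

(* The L^r_x L^q_p norm: r is the outer exponent (in x), q the inner (in p). *)
Definition mixed_norm (R : realType) (r q : \bar R) (f : R -> R -> R[i]) :
    \bar R :=
  Lnorm (@lebesgue_measure R) r
    (fun x => Lnorm (torus_measure R) q (fun p => (Normc.normc (f x p))%:E)).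

Definition weighted_mixed_norm (R : realType) (r q : \bar R) (W : R -> R)
    (f : R -> R -> R[i]) : \bar R :=
  mixed_norm r q (fun x p => f x p * (W p)%:C).

Definition omega (R : realType) (p : R) : R := `|sin (p / 2)|.

(* omega is not differentiable on 2 pi Z; derive1 takes an unspecified value on
   this null set. *)
Definition velocity (R : realType) : R -> R := derive1 (@omega R).

Definition transport (R : realType) (t : R) (f : R -> R -> R[i]) :
    R -> R -> R[i] :=
  fun x p => f (x - velocity p * t) p.

(* 1/q - 1/r, where (+oo)^-1 = 0 in \bar R. *)
Definition exponent_gap (R : realType) (q r : \bar R) : R :=
  fine (q^-1 - r^-1)%E.

(* Main.v *)
Require Import Defs.
From HB Require Import structures.
From mathcomp Require Import all_boot all_order all_algebra.
From mathcomp Require Import all_classical all_reals all_analysis.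
From mathcomp Require Import complex.
From mathcomp Require Import measurable_realfun ess_sup_inf ring lra.

(* For q < r put s = r / q, theta = 1 - q / r and u(x) = int |f(x - t v(p), p)|^q dp.
   Testing u against h >= 0, Tonelli and a translation in x give
   int u h = int int |f(y, p)|^q h(y + t v(p)) dp dy.  Hoelder's inequality in p
   with exponents s and 1 / theta, after splitting off omega^theta, leaves the
   factor (int h(y + t v(p))^(1 / theta) omega(p) dp)^theta; since
   t v'(p) = - (t / 4) omega(p), the substitution x = y + t v(p) bounds it by a power
   of int h^(1 / theta), uniformly in y.  Taking for h truncations of u^(s - 1)
   yields the L^s bound on u.  For r = +oo the weighted sup norm in p bounds u(x)
   pointwise and the same substitution concludes; for q = r only Tonelli and
   translation invariance are needed. *)

Import Order.TTheory GRing.Theory Num.Theory.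
Import numFieldNormedType.Exports.

Local Open Scope classical_set_scope.
Local Open Scope ring_scope.
Local Open Scope complex_scope.

(** * Integrals and Lebesgue norms compared almost everywhere, without measurability *)

Section ae_without_measurability.
Local Open Scope ereal_scope.
Context {d : measure_display} {T : measurableType d} {R : realType}.
Variable mu : {measure set T -> \bar R}.
Implicit Types f g : T -> \bar R.

Import HBNNSimple.

(* The integral of a non-negative function is a supremum over simple functions
   below it, so neither function has to be measurable. *)
Lemma ge0_ae_le_integral_nomeas f g :
  (forall x, 0 <= f x) -> (forall x, 0 <= g x) ->
  {ae mu, forall x, f x <= g x} -> \int[mu]_x f x <= \int[mu]_x g x.
Proof.
move=> f0 g0 [N [mN N0 fgN]].
rewrite !ge0_integralTE//; apply/ge_ereal_sup => _ [h/= hf <-].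
pose h' := proj_nnsfun h (measurableC mN).
have h'E x : h' x = (h \_ (~` N)) x by rewrite (mrestrict h (measurableC mN)).
apply: (@le_trans _ _ (sintegral mu h')); last first.
  apply: ereal_sup_ubound; exists h' => // x.
  rewrite h'E patchE; case: ifPn => //= xN; apply: le_trans (hf x) _.
  by apply: contrapT => H; move: xN; rewrite inE => /(_ (fgN _ H)).
rewrite -!integralT_nnsfun (@ge0_negligible_integral _ _ _ _ setT N)//; last 2 first.
- exact/measurable_EFinP.
- by move=> x _; rewrite lee_fin.
rewrite setTD integral_mkcond le_eqVlt; apply/orP; left; apply/eqP.
by apply: eq_integral => x _; rewrite h'E !patchE; case: ifPn.
Qed.

Lemma ge0_ae_eq_integral_nomeas f g :
  (forall x, 0 <= f x) -> (forall x, 0 <= g x) ->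
  {ae mu, forall x, f x = g x} -> \int[mu]_x f x = \int[mu]_x g x.
Proof.
move=> f0 g0 fg; apply/eqP; rewrite eq_le !ge0_ae_le_integral_nomeas//.
- by apply: filterS fg => x ->.
- by apply: filterS fg => x ->.
Qed.

Lemma ae_eq_Lnorm p f g :
  {ae mu, forall x, f x = g x} -> Lnorm mu p f = Lnorm mu p g.
Proof.
move=> fg; rewrite unlock; case: p => [p||] //.
- congr (_ `^ _); apply: ge0_ae_eq_integral_nomeas => [x|x|]; rewrite ?poweR_ge0//.
  by apply: filterS fg => x ->.
- by case: ifP => // _; apply: eq_ess_sup; apply: filterS fg => x /= ->.
- by case: ifP => // _; apply: eq_ess_inf; apply: filterS fg => x /= ->.
Qed.

End ae_without_measurability.

(** Lets a function be replaced by a Borel representative inside a mixed norm: neither [F] nor [G]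
    has to be measurable, only equal on almost every slice. *)
Lemma ae_eq_Lnorm_Lnorm {d1 d2 : measure_display} {T1 : measurableType d1}
    {T2 : measurableType d2} {R : realType} (m1 : {measure set T1 -> \bar R})
    (m2 : {measure set T2 -> \bar R}) (r q : \bar R) (F G : T1 -> T2 -> \bar R) :
  {ae m1, forall x, {ae m2, forall y, F x y = G x y}} ->
  Lnorm m1 r (fun x => Lnorm m2 q (F x)) = Lnorm m1 r (fun x => Lnorm m2 q (G x)).
Proof.
by move=> FG; apply: ae_eq_Lnorm; apply: filterS FG => x; exact: ae_eq_Lnorm.
Qed.

(** * Null sets of a product measure and their slices *)

Section product_null_sets.
Local Open Scope ereal_scope.
Context {d1 d2 : measure_display} {T1 : measurableType d1} {T2 : measurableType d2}
  {R : realType}.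
Variables (m1 : {sigma_finite_measure set T1 -> \bar R})
  (m2 : {sigma_finite_measure set T2 -> \bar R}).

Lemma measurable_slice1 (N : set (T1 * T2)) (x : T1) :
  measurable N -> measurable [set y | N (x, y)].
Proof. by move=> mN; have := measurable_xsection x mN; rewrite xsectionE. Qed.

Lemma measurable_slice2 (N : set (T1 * T2)) (y : T2) :
  measurable N -> measurable [set x | N (x, y)].
Proof. by move=> mN; have := measurable_ysection y mN; rewrite ysectionE. Qed.

(** The product measure is the integral of the slice measures, and a non-negative integral vanishes
    exactly when its integrand does almost everywhere. *)
Lemma product_null1P (N : set (T1 * T2)) : measurable N ->
  (m1 \x m2) N = 0 <-> {ae m1, forall x, m2 [set y | N (x, y)] = 0}.
Proof.
move=> mN; rewrite (_ : (m1 \x m2) N = \int[m1]_x `|m2 (xsection N x)|); last first.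
  by rewrite /product_measure1; apply: eq_integral => x _; rewrite /= gee0_abs.
rewrite (ae_eq_integral_abs m1 measurableT); last exact: measurable_fun_xsection.
split; apply: filterS => x /=; rewrite xsectionE; first exact.
by move=> ->.
Qed.

(** The product measure is defined by integrating over the first factor, so Tonelli for the
    indicator of [N] exchanges the order before slices are used. *)
Lemma product_null2P (N : set (T1 * T2)) : measurable N ->
  (m1 \x m2) N = 0 <-> {ae m2, forall y, m1 [set x | N (x, y)] = 0}.
Proof.
move=> mN.
have -> : (m1 \x m2) N = \int[m1 \x m2]_z (\1_N z)%:E.
  by rewrite integral_indic// setIT.
rewrite fubini_tonelli2//; last exact/measurable_EFinP.
rewrite (_ : \int[m2]_y _ = \int[m2]_y `|m1 (ysection N y)|); last first.
  apply: eq_integral => y _; rewrite /fubini_G gee0_abs//.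
  have -> : m1 (ysection N y) = \int[m1]_x (\1_(ysection N y) x)%:E.
    by rewrite integral_indic// ?setIT//; exact: measurable_ysection.
  apply: eq_integral => x _; congr (_%:E); rewrite !indicE; congr (nat_of_bool _)%:R.
  by rewrite mem_ysection.
rewrite (ae_eq_integral_abs m2 measurableT); last exact: measurable_fun_ysection.
split; apply: filterS => y /=; rewrite ysectionE; first exact.
by move=> ->.
Qed.

Lemma negligible_measure0 {d : measure_display} {T : measurableType d}
    (mu : {measure set T -> \bar R}) (A : set T) :
  measurable A -> {ae mu, forall x, ~ A x} <-> mu A = 0.
Proof.
move=> mA; split=> [[B [mB B0 sB]]|A0].
  by apply: (subset_measure0 mA mB _ B0) => x Ax; apply: sB => nA; exact: nA Ax.
by exists A; split=> // x /=; exact: contrapT.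
Qed.

End product_null_sets.

(** * Translation invariance of Lebesgue measure and of its integral *)

Section translation.
Local Open Scope ereal_scope.
Context {R : realType}.
Local Notation mu := (@lebesgue_measure R).

(** The push-forward under the translation gives each half-open interval its length, and Lebesgue
    measure is the only measure that does. *)
Lemma lebesgue_measure_translation (c : R) (A : set (measurableTypeR R)) :
  measurable A -> mu ((fun x => x + c)%R @^-1` A) = mu A.
Proof.
move=> mA.
pose phi : measurableTypeR R -> measurableTypeR R := fun x => (x + c)%R.
have mphi : measurable_fun setT phi by exact: measurable_funD.
pose phi' : {mfun measurableTypeR R >-> measurableTypeR R} :=
  HB.pack phi (isMeasurableFun.Build _ _ _ _ _ mphi).
rewrite -[LHS]/(pushforward mu phi' A).
apply/esym; apply: lebesgue_measure_unique => //= _ [[a b]] _ <-.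
rewrite /pushforward/= (_ : _ @^-1` _ = `]a - c, b - c]%classic)%R; last first.
  by apply/seteqP; split=> x /=; rewrite !in_itv/= /phi ltrBlDr lerBrDr.
by rewrite !lebesgue_measure_itv/= !lte_fin ltrD2r opprB -!EFinD addrA subrK.
Qed.

Lemma ge0_integral_translation (c : R) (f : measurableTypeR R -> \bar R) :
  measurable_fun setT f -> (forall x, 0 <= f x) ->
  \int[mu]_x f (x + c)%R = \int[mu]_x f x.
Proof.
move=> mf f0.
pose phi : measurableTypeR R -> measurableTypeR R := fun x => (x + c)%R.
have mphi : measurable_fun setT phi by exact: measurable_funD.
pose phi' : {mfun measurableTypeR R >-> measurableTypeR R} :=
  HB.pack phi (isMeasurableFun.Build _ _ _ _ _ mphi).
rewrite -[LHS]/(\int[mu]_(x in phi @^-1` setT) (f \o phi) x).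
rewrite -ge0_integral_pushforward//.
apply: (@eq_measure_integral _ _ _ _ mu (pushforward mu phi')) => A mA _.
by rewrite /pushforward; exact: lebesgue_measure_translation.
Qed.

End translation.

(** * Weighted push-forwards dominated by Lebesgue measure *)

Section weighted_pushforward.
Local Open Scope ereal_scope.
Context {d : measure_display} {T : measurableType d} {R : realType}.
Variables (tau : {measure set T -> \bar R}) (F : T -> measurableTypeR R) (w : T -> R).
Local Notation mu := (@lebesgue_measure R).
Hypothesis mF : measurable_fun setT F.
Hypothesis mw : measurable_fun setT w.
Hypothesis w0 : forall p, (0 <= w p)%R.
Hypothesis weight_itv : forall a b : R, (a <= b)%R ->
  \int[tau]_p ((\1_(`]a, b] : set R) (F p))%:E * (w p)%:E) <= (b - a)%:E.

(** The push-forward under [F] of the measure with density [w] with respect to [tau]. *)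
Let Phi (A : set R) := \int[tau]_p ((\1_A (F p))%:E * (w p)%:E).

Let Phi_ge0 A p : 0 <= (\1_A (F p))%:E * (w p)%:E.
Proof. by rewrite mule_ge0// lee_fin. Qed.

Let mPhi (A : set (measurableTypeR R)) : measurable A ->
  measurable_fun setT (fun p => (\1_A (F p))%:E * (w p)%:E).
Proof.
move=> mA; apply: emeasurable_funM; last exact/measurable_EFinP.
apply/measurable_EFinP; exact: (measurableT_comp (measurable_indic mA)).
Qed.

(* Compare with every covering by half-open intervals. *)
Let Phi_le (A : set (measurableTypeR R)) : measurable A -> Phi A <= mu A.
Proof.
move=> mA; rewrite /lebesgue_measure/= /lebesgue_stieltjes_measure/=.
rewrite /measure_extension/=; apply/le_ereal_inf_tmp => _ [I [mI AI] <-].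
have mI' k : measurable (I k : set (measurableTypeR R)).
  by apply: sub_sigma_algebra; exact: mI.
apply: (@le_trans _ _ (\int[tau]_p (\sum_(k <oo) ((\1_(I k) (F p))%:E * (w p)%:E)))).
  apply: ge0_le_integral => //.
  - exact: mPhi.
  - by apply: ge0_emeasurable_sum => // k _; exact: mPhi.
  - move=> p _; rewrite indicE; have [/set_mem AFp|_] := boolP (F p \in A); last first.
      by rewrite mul0e; apply: nneseries_ge0 => k _ _.
    have [k _ Ik] := AI _ AFp.
    rewrite (nneseriesD1 (n := k))//= indicE mem_set//.
    by rewrite leeDl//; apply: nneseries_ge0 => j _ _.
rewrite integral_nneseries//; last by move=> k; exact: mPhi.
apply: lee_nneseries => [k _ _|k _]; first by apply: integral_ge0 => p _.
have [[a b] _ <-] := mI k.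
have [ab|ba] := leP a b.
  by rewrite wlength_itv_bnd//; exact: weight_itv.
rewrite /= set_itv_ge ?bnd_simp -?leNgt ?(ltW ba)// wlength0.
by under eq_integral do rewrite indicE in_set0 mul0e; rewrite integral0.
Qed.

Import HBNNSimple.

(** [Phi_le] is the case of an indicator; linearity gives simple functions, and monotone convergence
    along an approximation from below gives [h]. *)
Lemma ge0_integral_weighted_pushforward_le (h : measurableTypeR R -> \bar R) :
  measurable_fun setT h -> (forall x, 0 <= h x) ->
  \int[tau]_p (h (F p) * (w p)%:E) <= \int[mu]_x h x.
Proof.
move=> mh h0.
pose g := nnsfun_approx measurableT mh.
have g_h n x : (g n x)%:E <= h x.
  by rewrite /g nnsfun_approxE; exact: le_approx.
have nd_gw p : {homo (fun n => (g n (F p))%:E * (w p)%:E) : n m / (n <= m)%N >-> n <= m}.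
  move=> n m nm; rewrite lee_wpmul2r ?lee_fin//.
  by have /lefP := nd_nnsfun_approx measurableT mh nm; exact.
have mgw n : measurable_fun setT (fun p => (g n (F p))%:E * (w p)%:E).
  apply: emeasurable_funM; last exact/measurable_EFinP.
  by apply/measurable_EFinP; apply: measurableT_comp.
have gw0 n p : 0 <= (g n (F p))%:E * (w p)%:E by rewrite mule_ge0// lee_fin.
have -> : \int[tau]_p (h (F p) * (w p)%:E) =
          \int[tau]_p (limn (fun n => (g n (F p))%:E * (w p)%:E)).
  apply: eq_integral => p _; apply/esym/cvg_lim => //.
  by apply: cvgeZr => //; exact: (cvg_nnsfun_approx measurableT mh).
rewrite (monotone_convergence _ measurableT mgw)//.
apply: lime_le.
  apply: ereal_nondecreasing_is_cvgn => m n mn.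
  by apply: ge0_le_integral => // p _; exact: nd_gw.
apply: nearW => n.
apply: (@le_trans _ _ (\int[mu]_x (g n x)%:E)); last first.
  by apply: ge0_le_integral => // [x _|]; rewrite ?lee_fin//; exact/measurable_EFinP.
rewrite integralT_nnsfun sintegralE.
have -> : \int[tau]_p ((g n (F p))%:E * (w p)%:E) =
   \int[tau]_p (\sum_(k \in range (g n)) (k%:E * ((\1_(g n @^-1` [set k]) (F p))%:E * (w p)%:E))).
  apply: eq_integral => p _; rewrite [in LHS]fimfunE -fsumEFin//.
  rewrite ge0_mule_fsuml; last by move=> k; rewrite EFinM nnfun_muleindic_ge0.
  by apply: eq_fsbigr => k _; rewrite EFinM muleA.
rewrite ge0_integral_fsum//; last 2 first.
- by move=> k; apply: measurable_funeM; exact: mPhi.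
(* A non-negative simple function has empty level sets at negative [k], so these terms vanish. *)
- move=> k p _; have [k0|k0] := leP 0%R k; first by rewrite mule_ge0.
  by rewrite preimage_nnfun0// indicE in_set0 mul0e mule0.
rewrite !fsbig_finite//=; apply: lee_sum => k _.
have [k0|k0] := leP 0%R k.
  rewrite ge0_integralZl_EFin//; last exact: mPhi.
  by rewrite lee_wpmul2l ?lee_fin//; exact: Phi_le.
rewrite preimage_nnfun0// measure0 mule0.
by under eq_integral do rewrite indicE in_set0 mul0e mule0; rewrite integral0.
Qed.

End weighted_pushforward.

(** * The torus, the group velocity and the change of variables along the flow *)

Section torus.
Local Open Scope ereal_scope.
Context {R : realType}.
Local Notation mu := (@lebesgue_measure R).
Local Notation tau := (torus_measure R).

(** The formula for the velocity on the open interval from 0 to 2 pi. Being continuous on the whole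
    line it is measurable, and it replaces [velocity] up to a null set. *)
Definition branch_velocity (p : R) : R := (cos (p / 2) / 2)%R.

Lemma torus_measure_le (A : set (measurableTypeR R)) :
  measurable A -> tau A <= mu A.
Proof.
by move=> mA; apply: measureIl.
Qed.

(** The open interval misses only the point 0 of the fundamental domain. Both the formula for the
    velocity and the positivity of [omega] are available only on the open interval. *)
Lemma ae_torus (P : R -> Prop) :
  (forall p, 0 < p < 2 * pi -> P p)%R -> {ae tau, forall p, P p}.
Proof.
move=> HP; exists (~` `]0%R, (2 * pi)%R[%classic); split.
- by apply: measurableC.
- apply/eqP; rewrite -measure_le0 -(@lebesgue_measure_set1 R 0).
  apply: le_measure; rewrite ?inE.
  + by apply: measurableI => //; exact: measurableC.
  + exact: measurable_set1.
  + move=> p [/=]; rewrite !in_itv/= => /negP.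
    rewrite negb_and -!leNgt => /orP[p0|p2] /andP[p0' p2'].
      by apply/eqP; rewrite eq_le p0 p0'.
    by rewrite leNgt p2' in p2.
- by move=> p nPp; rewrite /= in_itv/= => p02; exact/nPp/HP.
Qed.

Lemma torus_measure_setT : tau setT = (2 * pi)%:E.
Proof.
rewrite /torus_measure /= /mrestr setTI lebesgue_measure_itv/= lte_fin.
by rewrite mulr_gt0 ?pi_gt0// oppr0 addr0.
Qed.

Lemma sin_half_gt0 (p : R) : (0 < p < 2 * pi -> 0 < sin (p / 2))%R.
Proof.
by move=> /andP[p0 p2]; apply: sin_gt0_pi; rewrite divr_gt0//= ltr_pdivrMr// mulrC.
Qed.

Lemma sin_half_ge0 (p : R) : (0 <= p <= 2 * pi -> 0 <= sin (p / 2))%R.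
Proof.
move=> /andP[p0 p2]; apply: sin_ge0_pi; rewrite divr_ge0//=.
by rewrite ler_pdivrMr// mulrC.
Qed.

Lemma omega_ge0 (p : R) : (0 <= omega p)%R.
Proof. exact: normr_ge0. Qed.

Lemma is_derive_half (p : R) : is_derive p 1%R (fun x : R => x / 2)%R 2^-1%R.
Proof.
rewrite (_ : (fun x : R => x / 2)%R = (2^-1 \*: @id R)%R); last first.
  by apply/funext => x; rewrite /= mulrC.
by have := is_deriveZ 2^-1%R (is_derive_id p (1 : R)%R); rewrite /GRing.scale/= mulr1.
Qed.

Lemma is_derive_sin_half (p : R) :
  is_derive p 1%R (fun x : R => sin (x / 2))%R (branch_velocity p).
Proof. exact: (is_derive1_comp (is_derive_sin _) (is_derive_half p)). Qed.

Lemma is_derive_cos_half (p : R) :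
  is_derive p 1%R (fun x : R => - 2 * cos (x / 2))%R (sin (p / 2)).
Proof.
have := is_deriveZ (- 2)%R (is_derive1_comp (is_derive_cos _) (is_derive_half p)).
by congr is_derive; rewrite /GRing.scale/= mulrA mulrNN mulrAC divff ?mul1r.
Qed.

(** Near such a [p] the sine is positive, so [omega] coincides with the smooth function sin(p / 2)
    on a neighbourhood. *)
Lemma velocityE (p : R) : (0 < p < 2 * pi)%R -> velocity p = branch_velocity p.
Proof.
move=> p02; rewrite /velocity derive1E.
rewrite -[RHS](@derive_val _ _ _ _ _ _ _ (is_derive_sin_half p)).
apply: near_eq_derive.
have /near_in_itvoo : p \in `]0%R, (2 * pi)%R[ by rewrite in_itv.
by apply: filterS => x; rewrite in_itv/= => /sin_half_gt0 x0; rewrite /omega gtr0_norm.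
Qed.

Lemma continuous_branch_velocity : continuous branch_velocity.
Proof.
move=> p; apply: cvgMl; apply: (@continuous_comp _ _ _ (fun x : R => x / 2)%R).
  by apply: cvgMl; exact: cvg_id.
exact: continuous_cos.
Qed.

Lemma continuous_sin_half : continuous (fun p : R => sin (p / 2)).
Proof.
move=> p; apply: (@continuous_comp _ _ _ (fun x : R => x / 2)%R).
  by apply: cvgMl; exact: cvg_id.
exact: continuous_sin.
Qed.

Lemma integral_sin_half (a b : R) : (a <= b)%R ->
  \int[mu]_(p in `[a, b]) (sin (p / 2))%:E = (2 * (cos (a / 2) - cos (b / 2)))%:E.
Proof.
rewrite le_eqVlt => /predU1P[->|ab].
  by rewrite set_itv1 integral_set1 subrr mulr0.
rewrite (@continuous_FTC2 _ _ (fun x : R => - 2 * cos (x / 2))%R)//.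
- by rewrite -EFinB; congr (_%:E); ring.
- by apply: continuous_subspaceT; exact: continuous_sin_half.
- have cF : continuous (fun x : R => - 2 * cos (x / 2))%R.
    move=> x; apply: differentiable_continuous; apply/derivable1_diffP.
    by have [] := is_derive_cos_half x.
  split.
  + by move=> x _; have [] := is_derive_cos_half x.
  + by apply: cvg_at_right_filter; exact: cF.
  + by apply: cvg_at_left_filter; exact: cF.
- by move=> x _; rewrite derive1E; exact: (@derive_val _ _ _ _ _ _ _ (is_derive_cos_half x)).
Qed.

(* The flow p |-> y + t v(p) has derivative - (t / 4) omega(p), so a level set
   of an interval of length b - a has omega-mass at most (b - a) / |t / 4|. *)
Lemma flow_weight_itv (t y a b : R) : (a <= b)%R ->
  \int[tau]_p ((\1_(`]a, b] : set R) (y + branch_velocity p * t)%R)%:E *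
     (`|t / 4| * omega p)%:E) <= (b - a)%:E.
Proof.
move=> ab; pose F (p : R) := (y + branch_velocity p * t)%R.
have cF : continuous F.
  move=> p; apply: cvgD; first exact: cvg_cst.
  by apply: cvgMl; exact: continuous_branch_velocity.
(* Closed intervals replace the half-open ones to make [S] compact, so that its extreme points [al]
   and [be] exist. *)
pose S := `[0%R, (2 * pi)%R]%classic `&` F @^-1` `[a, b]%classic.
have cS : compact S.
  apply: compact_closedI; first exact: segment_compact.
  by apply: preimage_closed => [p _|]; [exact: cF|exact: itv_closed].
have tau_f p : (0 < p < 2 * pi)%R -> F p \in `]a, b] -> S p.
  move=> /andP[p0 p2]; rewrite in_itv/= => /andP[aF Fb].
  by split; rewrite /= in_itv/= ltW//= ?ltW.
have [S0|S0] := eqVneq S set0.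
  rewrite (@ge0_ae_eq_integral_nomeas _ _ _ _ _ (cst 0)) ?integral0 ?lee_fin ?subr_ge0//.
    by move=> p; rewrite mule_ge0// lee_fin mulr_ge0 ?omega_ge0.
  apply: ae_torus => p p02 /=; rewrite indicE.
  have [/set_mem /= Fp|] := boolP (F p \in `]a, b]%classic); last by rewrite mul0e.
  by have := tau_f _ p02 Fp; rewrite S0.
have cid : {within S, continuous (@id R)} by apply: continuous_subspaceT => x; exact: cvg_id.
have /set0P S0' := S0.
have [al /set_mem [al02 Fal] min_al] := compact_EVT_min S0' cS cid.
have [be /set_mem [be02 Fbe] max_be] := compact_EVT_max S0' cS cid.
have albe : (al <= be)%R by apply: min_al; rewrite inE.
have al0 : (0 <= al)%R by move: al02; rewrite /= in_itv/= => /andP[].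
have be2 : (be <= 2 * pi)%R by move: be02; rewrite /= in_itv/= => /andP[].
(* Enlarging the level set to the interval between its extreme points only increases the integral,
   which then has an explicit primitive. *)
pose g (p : R) : \bar R := ((fun p => (`|t / 4| * omega p)%:E) \_ `[al, be]) p.
have g0 p : 0 <= g p.
  by rewrite /g patchE; case: ifPn => // _; rewrite lee_fin mulr_ge0 ?omega_ge0.
have momega : measurable_fun setT (fun p : measurableTypeR R => (`|t / 4| * omega p)%:E).
  apply/measurable_EFinP; apply: measurable_funM => //.
  apply: measurableT_comp => //.
  by apply: continuous_measurable_fun; exact: continuous_sin_half.
have mg : measurable_fun setT (g : measurableTypeR R -> \bar R).
  apply/(measurable_restrictT _ _).1 => //.
  exact: measurable_funTS.
apply: (@le_trans _ _ (\int[tau]_p g p)).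
  apply: ge0_ae_le_integral_nomeas => //.
    by move=> p; rewrite mule_ge0// lee_fin mulr_ge0 ?omega_ge0.
  apply: ae_torus => p p02 /=; rewrite indicE.
  have [/set_mem /= Fp|] := boolP (F p \in `]a, b]%classic); last by rewrite mul0e.
  have Sp := tau_f _ p02 Fp.
  by rewrite mul1e /g patchE mem_set//= in_itv/= min_al ?inE// max_be ?inE.
apply: (@le_trans _ _ (\int[mu]_p g p)).
  by apply: ge0_le_measure_integral => //; exact: torus_measure_le.
have sin_ge0 p : `[al, be]%classic p -> (0 <= sin (p / 2))%R.
  rewrite /= in_itv/= => /andP[p1 p2].
  by rewrite sin_half_ge0// (le_trans al0 p1)/= (le_trans p2 be2).
rewrite /g -integral_mkcond.
rewrite [leLHS](_ : _ =
    \int[mu]_(p in `[al, be]) ((`|t / 4|)%R%:E * (sin (p / 2))%:E)); last first.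
  by apply: eq_integral => p /set_mem /sin_ge0 s0; rewrite /omega (ger0_norm s0).
rewrite ge0_integralZl_EFin//; last first.
  apply: measurable_funTS; apply/measurable_EFinP.
  by apply: continuous_measurable_fun; exact: continuous_sin_half.
(* The integral equals [|F al - F be|], the distance of two points of [[a, b]]; the sign of [t]
   decides which one is larger. *)
rewrite integral_sin_half// -EFinM lee_fin.
move: Fal Fbe; rewrite /= !in_itv/= /F /branch_velocity => /andP[h1 h2] /andP[h3 h4].
rewrite normrM (@ger0_norm _ 4^-1)%R//.
by have [t0|t0] := ger0P t; lra.
Qed.

(** The weight is the Jacobian of the substitution x = y + t v(p). Its image is only a part of the
    line, hence an inequality, with a bound uniform in [y]. *)
Lemma flow_change_of_variables_le (t y : R) (h : measurableTypeR R -> \bar R) :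
  measurable_fun setT h -> (forall x, 0 <= h x) ->
  \int[tau]_p (h (y + branch_velocity p * t)%R * (`|t / 4| * omega p)%:E) <=
  \int[mu]_x h x.
Proof.
move=> mh h0; apply: ge0_integral_weighted_pushforward_le => //.
- apply: continuous_measurable_fun => p; apply: cvgD; first exact: cvg_cst.
  by apply: cvgMl; exact: continuous_branch_velocity.
- apply: measurable_funM => //; apply: measurableT_comp => //.
  by apply: continuous_measurable_fun; exact: continuous_sin_half.
- by move=> p; rewrite mulr_ge0 ?omega_ge0.
- by move=> a b; exact: flow_weight_itv.
Qed.

End torus.

(** At exponent [+oo], [Lnorm] is the essential supremum only if the total mass is positive, and 0
    otherwise. *)
Lemma lebesgue_measure_setT_gt0 (R : realType) :
  (0 < @lebesgue_measure R setT)%E.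
Proof.
have := @lebesgue_measure_itv R (Interval -oo%O +oo%O).
by rewrite set_itvNyy => ->; rewrite /= ?ltNyr ?ltry.
Qed.

(** * Measurability of inner norms and description of iterated norms *)

Section mixed_norms.
Local Open Scope ereal_scope.
Context {d : measure_display} {P : measurableType d} {R : realType}.
Local Notation mu := (@lebesgue_measure R).
Local Notation X := (measurableTypeR R).
Variable tau : {sigma_finite_measure set P -> \bar R}.

Lemma measurable_pair_slice {d' : measure_display} {Y : measurableType d'}
    (H : X * P -> Y) (x : X) :
  measurable_fun setT H -> measurable_fun setT (fun p => H (x, p)).
Proof. by move=> mH; exact: (measurableT_comp mH (measurable_pair1 x)). Qed.

Lemma measurable_pair_slice2 {d' : measure_display} {Y : measurableType d'}
    (H : X * P -> Y) (p : P) :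
  measurable_fun setT H -> measurable_fun setT (fun x => H (x, p)).
Proof. by move=> mH; exact: (measurableT_comp mH (measurable_pair2 p)). Qed.

Lemma measurable_gt_slice (H : X * P -> \bar R) (c : \bar R) :
  measurable_fun setT H -> measurable [set z | c < `|H z|].
Proof.
move=> mH; rewrite -[[set _ | _]]setTI; apply: measurable_lte => //.
exact: measurableT_comp.
Qed.

Lemma inner_ess_sup_leP (H : X * P -> \bar R) (c : \bar R) (x : X) :
  measurable_fun setT H ->
  ess_sup tau (fun p => `|H (x, p)|) <= c <-> tau [set p | c < `|H (x, p)|] = 0.
Proof.
move=> mH; rewrite -(rwP ess_supP) -negligible_measure0; last first.
  exact: (measurable_slice1 _ _ (measurable_gt_slice _ _ mH)).
by split; apply: filterS => p /=; rewrite leNgt => /negP.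
Qed.

(** For finite [q] this is Tonelli. For [+oo], the inner supremum exceeds [c] exactly where the
    slice of the superlevel set has non-zero measure, and slice measures depend measurably on
    [x]. *)
Lemma measurable_inner_Lnorm (q : \bar R) (H : X * P -> \bar R) :
  1 <= q -> measurable_fun setT H ->
  measurable_fun setT (fun x : X => Lnorm tau q (fun p => H (x, p))).
Proof.
move=> q1 mH; rewrite unlock; case: q q1 => [q||] // q1.
- apply: (@measurableT_comp _ _ _ _ _ _ (fun y => y `^ q^-1)) => /=.
    exact: measurable_poweR.
  apply: (@measurable_fun_fubini_tonelli_F _ _ _ _ _ tau (fun z => `|H z| `^ q)).
    apply: (@measurableT_comp _ _ _ _ _ _ (fun y => y `^ q)) => /=.
      exact: measurable_poweR.
    exact: measurableT_comp.
  by move=> z; exact: poweR_ge0.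
- case: (0 < tau [set: P]); last exact: measurable_cst.
  apply: (measurability _ (ErealGenOInfty.measurableE R)) => _ [_ [c ->] <-].
  rewrite setTI preimage_itvoy (_ : [set _ | _] = ~` [set x | tau (xsection [set z | c%:E < `|H z|] x) = 0]).
    apply: measurableC; rewrite -[[set _ | _]]setTI.
    exact: (measurable_fun_xsection tau (measurable_gt_slice H c%:E mH) measurableT
      (emeasurable_set1 0)).
  apply/seteqP; split => x /=; rewrite xsectionE -inner_ess_sup_leP//.
    by rewrite ltNge => /negP.
  by move=> /negP; rewrite -ltNge.
Qed.

(** Turns an iterated supremum, by slicing, into a null set of the product, on which a shear can
    act. *)
Lemma Lnorm_yyP (H : X * P -> \bar R) (c : \bar R) : 0 < tau setT ->
  measurable_fun setT H ->
  Lnorm mu +oo (fun x => Lnorm tau +oo (fun p => H (x, p))) <= c <->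
  (mu \x tau) [set z | c < `|H z|] = 0.
Proof.
move=> tau0 mH; rewrite product_null1P; last exact: measurable_gt_slice.
have mu0 := @lebesgue_measure_setT_gt0 R.
rewrite unlock mu0 tau0 -(rwP ess_supP).
split; apply: filterS => x; rewrite /= gee0_abs ?inner_ess_sup_leP//.
- by apply: ess_sup_gee => //; apply: nearW => p; exact: abse_ge0.
- by apply: ess_sup_gee => //; apply: nearW => p; exact: abse_ge0.
Qed.

Lemma Lnorm_diag (q : R) (H : X * P -> \bar R) : (0 < q)%R ->
  Lnorm mu q%:E (fun x => Lnorm tau q%:E (fun p => H (x, p))) =
  (\int[mu]_x \int[tau]_p (`|H (x, p)| `^ q)) `^ q^-1.
Proof.
move=> q0; rewrite {1}unlock; congr (_ `^ _); apply: eq_integral => x _.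
by rewrite gee0_abs ?Lnorm_ge0// poweR_Lnorm// gt_eqF.
Qed.

(** * The shear along [v] and its invariance properties for equal exponents *)

Variable v : P -> R.
Hypothesis mv : measurable_fun setT v.

(** The backward flow as a shear of phase space; time is absorbed in [v]. *)
Definition shift_flow (z : X * P) : X * P := ((z.1 - v z.2)%R, z.2).

Lemma measurable_shift_flow : measurable_fun setT shift_flow.
Proof.
apply: measurable_fun_pair => //=; apply: measurable_funB => //.
exact: measurableT_comp.
Qed.

Lemma measurable_preimage_shift_flow (N : set (X * P)) :
  measurable N -> measurable (shift_flow @^-1` N).
Proof.
move=> mN; rewrite -[_ @^-1` _]setTI; exact: measurable_shift_flow.
Qed.

(** For fixed [p] the shear translates the slice in [x], so slicing over the second variable reduces
    to translation invariance. *)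
Lemma shift_flow_null (N : set (X * P)) : measurable N ->
  (mu \x tau) (shift_flow @^-1` N) = 0 <-> (mu \x tau) N = 0.
Proof.
move=> mN; rewrite !product_null2P//; last exact: measurable_preimage_shift_flow.
have HE p : mu [set x | (shift_flow @^-1` N) (x, p)] = mu [set x | N (x, p)].
  by apply: (lebesgue_measure_translation (- v p)%R); exact: measurable_slice2.
by split; apply: filterS => p h; [exact: etrans (esym (HE p)) h|exact: etrans (HE p) h].
Qed.

(** Tonelli makes [x] the inner variable, where the shear is a translation. *)
Lemma ge0_integral_shift_flow (H : X * P -> \bar R) :
  measurable_fun setT H -> (forall z, 0 <= H z) ->
  \int[mu]_x \int[tau]_p H (shift_flow (x, p)) = \int[mu]_x \int[tau]_p H (x, p).
Proof.
move=> mH H0.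
have mHS : measurable_fun setT (H \o shift_flow).
  exact: (measurableT_comp mH measurable_shift_flow).
rewrite (@fubini_tonelli _ _ _ _ _ mu tau _ mHS (fun z => H0 _)).
rewrite (@fubini_tonelli _ _ _ _ _ mu tau H mH H0).
apply: eq_integral => p _.
apply: (ge0_integral_translation (- v p)%R (fun x => H (x, p))) => //.
exact: measurable_pair_slice2.
Qed.

Lemma shift_flow_Lnorm_diag (q : \bar R) (H : X * P -> \bar R) :
  1 <= q -> 0 < tau setT -> measurable_fun setT H ->
  Lnorm mu q (fun x => Lnorm tau q (fun p => H (shift_flow (x, p)))) =
  Lnorm mu q (fun x => Lnorm tau q (fun p => H (x, p))).
Proof.
move=> q1 tau0 mH; have mHS : measurable_fun setT (H \o shift_flow).
  exact: (measurableT_comp mH measurable_shift_flow).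
case: q q1 => [q||] // q1.
- have q0 : (0 < q)%R by rewrite -lte_fin (lt_le_trans _ q1)// lte_fin.
  rewrite (Lnorm_diag q H q0); apply: etrans (Lnorm_diag q (H \o shift_flow) q0) _.
  apply: (congr1 (poweR^~ _)).
  apply: (ge0_integral_shift_flow (fun z => `|H z| `^ q)).
    apply: (@measurableT_comp _ _ _ _ _ _ (fun y => y `^ q)) => /=.
      exact: measurable_poweR.
    exact: measurableT_comp.
  by move=> z; exact: poweR_ge0.
(* Two extended reals with the same upper bounds [c] are equal; here upper bounds correspond to null
   superlevel sets, which the shear respects. *)
- have HC c : (Lnorm mu +oo (fun x => Lnorm tau +oo (fun p => H (shift_flow (x, p)))) <= c) =
              (Lnorm mu +oo (fun x => Lnorm tau +oo (fun p => H (x, p))) <= c).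
    apply/idP/idP.
      move=> /(Lnorm_yyP (H \o shift_flow) _ tau0 mHS) h; apply/Lnorm_yyP => //.
      exact: ((shift_flow_null _ (measurable_gt_slice H c mH)).1 h).
    move=> /(Lnorm_yyP _ _ tau0 mH) h; apply/(Lnorm_yyP (H \o shift_flow)) => //.
    exact: ((shift_flow_null _ (measurable_gt_slice H c mH)).2 h).
  by apply/eqP; rewrite eq_le HC lexx -HC lexx.
Qed.

End mixed_norms.

(** * The dispersive estimate for finite exponents q < r *)

Section dispersive_estimate.
Local Open Scope ereal_scope.
Context {d : measure_display} {P : measurableType d} {R : realType}.
Local Notation mu := (@lebesgue_measure R).
Local Notation X := (measurableTypeR R).
Variables (tau : {sigma_finite_measure set P -> \bar R}) (v w : P -> R).
Hypothesis mv : measurable_fun setT v.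
Hypothesis mw : measurable_fun setT w.
Hypothesis w0 : forall p, (0 <= w p)%R.
Hypothesis w_gt0 : {ae tau, forall p, (0 < w p)%R}.
Variable G : X * P -> R.
Hypothesis mG : measurable_fun setT G.
Hypothesis G0 : forall z, (0 <= G z)%R.

Lemma measurable_fun_poweR {d' : measure_display} {T : measurableType d'}
    (f : T -> \bar R) (a : R) :
  measurable_fun setT f -> measurable_fun setT (fun x => f x `^ a).
Proof. by move=> mf; exact: (measurableT_comp (measurable_poweR a) mf). Qed.

Lemma measurable_fun_powR {d' : measure_display} {T : measurableType d'}
    (f : T -> R) (a : R) :
  measurable_fun setT f -> measurable_fun setT (fun x => f x `^ a)%R.
Proof. by move=> mf; exact: (measurableT_comp (measurable_powR a) mf). Qed.

Lemma powR_weight (a b g u : R) : (0 <= g)%R -> (0 <= u)%R ->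
  ((g * u `^ a) `^ b = g `^ b * u `^ (a * b))%R.
Proof. by move=> g0 u0; rewrite powRM ?powR_ge0// powRrM. Qed.

Section finite_exponents.
Variables q r : R.
Hypothesis q1 : (1 <= q)%R.
Hypothesis qr : (q < r)%R.

Let q0 : (0 < q)%R. Proof. exact: lt_le_trans q1. Qed.
Let r0 : (0 < r)%R. Proof. exact: lt_trans q0 qr. Qed.
Let qN0 : q != 0%R. Proof. by rewrite gt_eqF. Qed.
Let rN0 : r != 0%R. Proof. by rewrite gt_eqF. Qed.
Let gap := (q^-1 - r^-1)%R.
Let s := (r / q)%R.
Let th := (1 - q / r)%R.

Let s_gt1 : (1 < s)%R. Proof. by rewrite /s ltr_pdivlMr// mul1r. Qed.
Let s_gt0 : (0 < s)%R. Proof. exact: lt_trans s_gt1. Qed.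
Let th_gt0 : (0 < th)%R.
Proof. by rewrite /th subr_gt0 ltr_pdivrMr// mul1r. Qed.
Let thN0 : th != 0%R. Proof. by rewrite gt_eqF. Qed.
Let sV : (s^-1 = q / r)%R. Proof. by rewrite /s invf_div. Qed.
Let s_th : (s^-1 + th^-1^-1 = 1)%R.
Proof. by rewrite sV invrK /th addrC subrK. Qed.
Let ths : (th * s = s - 1)%R.
Proof. by rewrite /th /s mulrBl mul1r mulrA divfK// divff. Qed.
(** Since [gap] is [th / q], the weight in the norm of exponent [r] and the factor [w ^ (- th)] in
    the norm of exponent [s] carry the same power of [w]. *)
Let gapr : (gap * r = th * s)%R.
Proof. by rewrite ths /gap /s mulrBl mulVf// mulrC. Qed.
Let W (y : X) := Lnorm tau r%:E (fun p => (G (y, p) * w p `^ (- gap))%:E).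

Let mW : measurable_fun setT W.
Proof.
apply: (measurable_inner_Lnorm _ _ (fun z => (G z * w z.2 `^ (- gap))%:E)).
  by rewrite lee_fin (le_trans q1)// ltW.
apply/measurable_EFinP; apply: measurable_funM => //.
by apply: measurable_fun_powR; exact: measurableT_comp.
Qed.

(** Hoelder with the conjugate exponents [s] and [1 / th], for the factors [G ^ q * w ^ (- th)] and
    [k * w ^ th]. The weights cancel only where [w] is positive, thus almost everywhere. *)
Let hoelder_slice (y : X) (k : P -> R) :
  measurable_fun setT k -> (forall p, 0 <= k p)%R ->
  \int[tau]_p (G (y, p) `^ q * k p)%:E <=
  W y `^ q * (\int[tau]_p (k p `^ th^-1 * w p)%:E) `^ th.
Proof.
move=> mk k0.
pose f p := (G (y, p) `^ q * w p `^ (- th))%R.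
pose g p := (k p * w p `^ th)%R.
have f0 p : (0 <= f p)%R by rewrite mulr_ge0// powR_ge0.
have g0 p : (0 <= g p)%R by rewrite mulr_ge0// powR_ge0.
have mf : measurable_fun setT f.
  apply: measurable_funM; apply: measurable_fun_powR => //.
  exact: measurable_pair_slice.
have mg : measurable_fun setT g.
  by apply: measurable_funM => //; exact: measurable_fun_powR.
have thV_gt0 : (0 < th^-1)%R by rewrite invr_gt0.
have := hoelder tau mf mg s_gt0 thV_gt0 s_th.
have -> : Lnorm tau 1 (EFin \o (f \* g)%R) = \int[tau]_p (G (y, p) `^ q * k p)%:E.
  rewrite Lnorm1; apply: ge0_ae_eq_integral_nomeas => [p|p|].
  - exact: abse_ge0.
  - by rewrite lee_fin mulr_ge0// powR_ge0.
  - apply: filterS w_gt0 => p wp; rewrite /= ger0_norm ?mulr_ge0 ?powR_ge0//.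
    congr (_%:E); rewrite /f /g mulrACA powRN mulVf ?mulr1//.
    by rewrite gt_eqF// powR_gt0.
have -> : Lnorm tau s%:E (EFin \o f) = W y `^ q.
  rewrite /W unlock -poweRrM (_ : r^-1 * q = s^-1)%R; last by rewrite sV mulrC.
  apply: (congr1 (poweR^~ _)); apply: eq_integral => p _.
  rewrite [`|(EFin \o f) p|]gee0_abs ?lee_fin// gee0_abs; last first.
    by rewrite lee_fin mulr_ge0// powR_ge0.
  rewrite !poweR_EFin /f !powR_weight ?powR_ge0// -powRrM !mulNr gapr.
  by rewrite (_ : q * s = r)%R// /s mulrC divfK.
have -> // : Lnorm tau th^-1%:E (EFin \o g) = (\int[tau]_p (k p `^ th^-1 * w p)%:E) `^ th.
rewrite unlock invrK; apply: (congr1 (poweR^~ _)); apply: eq_integral => p _.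
by rewrite gee0_abs ?lee_fin// poweR_EFin /= powR_weight// divff// powRr1.
Qed.

Hypothesis flow_le : forall (y : R) (h : X -> \bar R),
  measurable_fun setT h -> (forall x, 0 <= h x) ->
  \int[tau]_p (h (y + v p)%R * (w p)%:E) <= \int[mu]_x h x.

Let u (x : X) := \int[tau]_p (G (shift_flow v (x, p)) `^ q)%:E.
(** The [q]-th power of the right-hand norm of the estimate. *)
Let D := \int[mu]_y (W y `^ q).

Let mGS : measurable_fun setT (G \o shift_flow v).
Proof. exact: (measurableT_comp mG (measurable_shift_flow v mv)). Qed.

Let measurable_u : measurable_fun setT u.
Proof.
apply: (@measurable_fun_fubini_tonelli_F _ _ _ _ _ tau
  (fun z => (G (shift_flow v z) `^ q)%:E)).
  by apply/measurable_EFinP; exact: measurable_fun_powR.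
by move=> z; rewrite lee_fin powR_ge0.
Qed.

Let u_ge0 x : 0 <= u x.
Proof. by apply: integral_ge0 => p _; rewrite lee_fin powR_ge0. Qed.

Let D_ge0 : 0 <= D.
Proof. by apply: integral_ge0 => y _; exact: poweR_ge0. Qed.

(** Undoing the shear moves the flow from [G] onto [h]. Then [hoelder_slice] applies at each [y] to
    h(y + v(p)), and [flow_le] bounds the remaining factor independently of [y]. *)
Let bilinear (h : X -> R) : measurable_fun setT h -> (forall x, 0 <= h x)%R ->
  \int[mu]_x (u x * (h x)%:E) <= D * (\int[mu]_x (h x `^ th^-1)%:E) `^ th.
Proof.
move=> mh h0.
pose H (z : X * P) := (G z `^ q * h (z.1 + v z.2)%R)%:E.
have mhv : measurable_fun setT (fun z : X * P => h (z.1 + v z.2)%R).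
  apply: (measurableT_comp mh); apply: measurable_funD => //.
  exact: measurableT_comp.
have mH : measurable_fun setT H.
  apply/measurable_EFinP; apply: measurable_funM => //.
  exact: measurable_fun_powR.
have H0 z : 0 <= H z by rewrite lee_fin mulr_ge0// powR_ge0.
have -> : \int[mu]_x (u x * (h x)%:E) = \int[mu]_x \int[tau]_p H (shift_flow v (x, p)).
  apply: eq_integral => x _.
  rewrite muleC -ge0_integralZl_EFin//.
  - by apply: eq_integral => p _; rewrite /H /= subrK -EFinM mulrC.
  - by move=> p _; rewrite lee_fin powR_ge0.
  - apply/measurable_EFinP; apply: measurable_fun_powR.
    exact: (measurable_pair_slice (G \o shift_flow v)).
rewrite ge0_integral_shift_flow//.
rewrite muleC -ge0_integralZl//; last 3 first.
- by apply: measurable_fun_poweR; exact: mW.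
- by move=> y _; exact: poweR_ge0.
- exact: poweR_ge0.
apply: ge0_le_integral => //.
- by move=> y _; exact: integral_ge0.
- exact: measurable_fun_fubini_tonelli_F.
- by apply: measurable_funeM; apply: measurable_fun_poweR; exact: mW.
move=> y _; rewrite muleC.
apply: le_trans (hoelder_slice y (fun p => h (y + v p)%R) _ _) _ => //.
  exact: (measurable_pair_slice (fun z : X * P => h (z.1 + v z.2)%R)).
rewrite lee_wpmul2l ?poweR_ge0// gt0_ler_poweR//.
- exact: ltW.
- by rewrite in_itv/= leey andbT; apply: integral_ge0 => p _; rewrite lee_fin mulr_ge0 ?powR_ge0.
- by rewrite in_itv/= leey andbT; apply: integral_ge0 => p _; rewrite lee_fin powR_ge0.
apply: (flow_le y (fun x => (h x `^ th^-1)%:E)).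
  by apply/measurable_EFinP; exact: measurable_fun_powR.
by move=> x; rewrite lee_fin powR_ge0.
Qed.

(** * Truncation of [u] and the bound on its integral of power [s] *)

Let trunc (n : nat) (x : X) : R := fine (Order.min (u x) n%:R%:E).

Let truncE n x : (trunc n x)%:E = Order.min (u x) n%:R%:E.
Proof.
rewrite /trunc fineK// ge0_fin_numE; last by rewrite le_min u_ge0 lee_fin ler0n.
by rewrite gt_min ltry orbT.
Qed.

Let trunc_ge0 n x : (0 <= trunc n x)%R.
Proof. by rewrite -lee_fin truncE le_min u_ge0 lee_fin ler0n. Qed.

Let trunc_le n x : (trunc n x)%:E <= u x.
Proof. by rewrite truncE ge_min lexx. Qed.

Let trunc_le_nat n x : (trunc n x <= n%:R)%R.
Proof. by rewrite -lee_fin truncE ge_min lexx orbT. Qed.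

Let trunc_nd x : {homo trunc^~ x : m n / (m <= n)%N >-> (m <= n)%R}.
Proof.
move=> m n mn; rewrite -lee_fin !truncE le_min2//.
by rewrite lee_fin ler_nat.
Qed.

Let mtrunc n : measurable_fun setT (trunc n).
Proof.
apply/measurable_EFinP; rewrite (_ : EFin \o _ = fun x => mine (u x) n%:R%:E).
  by apply: measurable_mine.
by apply/funext => x /=; rewrite truncE.
Qed.

Let box (n : nat) : set X := `[- n%:R, n%:R]%classic%R.

Let box_nd k n x : (k <= n)%N -> x \in box k -> x \in box n.
Proof.
rewrite !inE /box /= !in_itv/= => kn /andP[xk1 xk2]; apply/andP; split.
  by apply: le_trans xk1; rewrite lerN2 ler_nat.
by apply: le_trans xk2 _; rewrite ler_nat.
Qed.

Let near_box x : \forall n \near \oo, x \in box n.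
Proof.
near=> n; rewrite inE /box /= in_itv/= -ler_norml.
by near: n; exact: nbhs_infty_ger.
Unshelve. all: by end_near. Qed.

(** Where [u] is finite the sequence is eventually constant; where it is infinite the truncation is
    [n], and [n ^ s] is at least [n] because [s > 1]. *)
Let cvg_trunc x :
  (trunc n x `^ s * \1_(box n) x)%:E @[n --> \oo] --> u x `^ s.
Proof.
case E : (u x) => [c| |]; last by have := u_ge0 x; rewrite E.
- apply: cvg_near_cst; near=> n.
  have xn : x \in box n by near: n; exact: near_box.
  rewrite indicE xn mulr1; congr (_ `^ _)%:E.
  have : (trunc n x)%:E = c%:E; last by case.
  rewrite truncE E; apply/min_idPl; rewrite lee_fin.
  by near: n; exact: nbhs_infty_ger.
- rewrite poweRyr ?gt_eqF//; apply/cvgeyPge => A; near=> n.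
  have xn : x \in box n by near: n; exact: near_box.
  have -> : trunc n x = n%:R.
    by have : (trunc n x)%:E = n%:R%:E; [rewrite truncE E minye|case].
  rewrite indicE xn mulr1 lee_fin.
  have n1 : (1 <= n%:R :> R)%R by near: n; exact: nbhs_infty_ger.
  apply: (@le_trans _ _ n%:R); first by near: n; exact: nbhs_infty_ger.
  by rewrite -{1}(powRr1 (ler0n _ n)) ler_powR// ltW.
Unshelve. all: by end_near. Qed.

Let mass n := \int[mu]_x (trunc n x `^ s * \1_(box n) x)%:E.

Let mmass n : measurable_fun setT (fun x => trunc n x `^ s * \1_(box n) x)%R.
Proof.
apply: measurable_funM; first exact: measurable_fun_powR.
by apply: measurable_indic; exact: measurable_itv.
Qed.

(** The integrand is bounded by [n ^ s] on a bounded interval. Finiteness is what allows a power of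
    [mass n] to be cancelled below. *)
Let mass_fin n : mass n < +oo.
Proof.
apply: (@le_lt_trans _ _ (\int[mu]_x ((n%:R `^ s)%:E * (\1_(box n) x)%:E))).
  apply: ge0_le_integral => //.
  - by move=> x _; rewrite lee_fin mulr_ge0// powR_ge0.
  - exact/measurable_EFinP.
  - apply: measurable_funeM; apply/measurable_EFinP.
    by apply: measurable_indic; exact: measurable_itv.
  - move=> x _; rewrite -EFinM lee_fin ler_wpM2r// ge0_ler_powR ?nnegrE ?trunc_le_nat//.
    exact: ltW.
rewrite ge0_integralZl_EFin ?powR_ge0//; last first.
  by apply/measurable_EFinP; apply: measurable_indic; exact: measurable_itv.
rewrite integral_indic//; last exact: measurable_itv.
have boxfin : mu (box n) < +oo.
  rewrite /box lebesgue_measure_itv/=; case: ifP => _; last by rewrite ltry.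
  by rewrite -EFinB ltry.
by rewrite setIT lte_mul_pinfty ?lee_fin ?powR_ge0.
Qed.

(* Testing the bilinear bound against a truncation of u ^ (s - 1). *)
Let mass_le n : D < +oo -> mass n <= D `^ s.
Proof.
move=> Dfin.
pose h x := (trunc n x `^ (s - 1) * \1_(box n) x)%R.
have h0 x : (0 <= h x)%R by rewrite mulr_ge0// powR_ge0.
have mh : measurable_fun setT h.
  apply: measurable_funM; first exact: measurable_fun_powR.
  by apply: measurable_indic; exact: measurable_itv.
have powS (m : R) : (0 <= m -> m * m `^ (s - 1) = m `^ s)%R.
  rewrite le_eqVlt => /predU1P[<-|m0]; first by rewrite mul0r powR0// gt_eqF.
  by rewrite -{1}(powRr1 (ltW m0)) -powRD ?(gt_eqF m0) ?implybT// addrC subrK.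
(* Since [(s - 1) / th = s], the integral of [h ^ (1 / th)] in the bilinear bound is again
   [mass n]. *)
have hE x : (h x `^ th^-1 = trunc n x `^ s * \1_(box n) x)%R.
  rewrite /h powRM ?powR_ge0// -powRrM (_ : (s - 1) * th^-1 = s)%R; last first.
    by rewrite -ths mulrAC divff// mul1r.
  congr (_ * _)%R; rewrite indicE; case: (_ \in _); rewrite ?powR1// powR0//.
  by rewrite invr_eq0.
have I_le : mass n <= D * mass n `^ th.
  rewrite {2}/mass; under eq_integral do rewrite -hE.
  apply: le_trans (bilinear h mh h0).
  apply: ge0_le_integral => //.
  - by move=> x _; rewrite lee_fin mulr_ge0// powR_ge0.
  - exact/measurable_EFinP.
  - by apply: emeasurable_funM => //; exact/measurable_EFinP.
  - move=> x _; rewrite /h -powS// -mulrA EFinM.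
    by rewrite lee_wpmul2r ?lee_fin// mulr_ge0// powR_ge0.
have mass0 : 0 <= mass n.
  by apply: integral_ge0 => x _; rewrite lee_fin mulr_ge0// powR_ge0.
move: I_le (mass_fin n) mass0; case: (mass n) => // I; rewrite lee_fin => + _ I0.
move: Dfin D_ge0; case: D => // E _; rewrite lee_fin => E0.
rewrite !poweR_EFin -EFinM !lee_fin => I_le.
have [->|IN0] := eqVneq I 0%R; first exact: powR_ge0.
have Igt0 : (0 < I)%R by rewrite lt_neqAle eq_sym IN0.
(* Cancels [I ^ th] in [I <= E * I ^ th], using [s^-1 + th = 1]. *)
have IE : (I `^ s^-1 <= E)%R.
  rewrite -(ler_pM2r (powR_gt0 th Igt0)); apply: le_trans I_le.
  rewrite -powRD ?IN0 ?implybT// (_ : s^-1 + th = 1)%R; last by rewrite -[X in (_ + X)%R]invrK s_th.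
  by rewrite powRr1.
rewrite -[leLHS](powRr1 I0) -(mulVf (lt0r_neq0 s_gt0)) powRrM.
by apply: ge0_ler_powR => //; rewrite ?nnegrE ?powR_ge0// ltW.
Qed.

Let integral_u_le : D < +oo -> \int[mu]_x (u x `^ s) <= D `^ s.
Proof.
move=> Dfin.
pose m n x := (trunc n x `^ s * \1_(box n) x)%:E.
have m_nd x : {homo m^~ x : k n / (k <= n)%N >-> k <= n}.
  move=> k n kn; rewrite lee_fin; apply: ler_pM => //; first exact: powR_ge0.
    by apply: ge0_ler_powR; rewrite ?nnegrE//; [exact: ltW|exact: trunc_nd].
  rewrite !indicE ler_nat; case xk : (x \in box k) => //.
  by rewrite (box_nd _ _ _ kn xk).
rewrite (_ : \int[mu]_x _ = \int[mu]_x limn (m^~ x)); last first.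
  apply: eq_integral => x _; apply/esym/cvg_lim => //.
  exact: cvg_trunc.
rewrite (monotone_convergence _ measurableT)//.
- apply: lime_le.
    apply: ereal_nondecreasing_is_cvgn => k n kn.
    apply: ge0_le_integral => //.
    + by move=> x _; rewrite lee_fin mulr_ge0// powR_ge0.
    + exact/measurable_EFinP.
    + exact/measurable_EFinP.
    + by move=> x _; exact: m_nd.
  by apply: nearW => n; exact: mass_le.
- by move=> n; exact/measurable_EFinP.
- by move=> n x _; rewrite lee_fin mulr_ge0// powR_ge0.
Qed.

Lemma dispersive_Lnorm_fin :
  Lnorm mu r%:E (fun x => Lnorm tau q%:E (fun p => (G (shift_flow v (x, p)))%:E)) <=
  Lnorm mu q%:E (fun y => Lnorm tau r%:E (fun p => (G (y, p) * w p `^ (- gap))%:E)).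
Proof.
have -> : Lnorm mu q%:E (fun y => Lnorm tau r%:E (fun p => (G (y, p) * w p `^ (- gap))%:E)) = D `^ q^-1.
  rewrite {1}unlock; apply: (congr1 (poweR^~ _)); apply: eq_integral => y _.
  by rewrite gee0_abs ?Lnorm_ge0.
have -> : Lnorm mu r%:E (fun x => Lnorm tau q%:E (fun p => (G (shift_flow v (x, p)))%:E)) =
    (\int[mu]_x (u x `^ s)) `^ r^-1.
  rewrite {1}unlock; apply: (congr1 (poweR^~ _)); apply: eq_integral => x _.
  rewrite gee0_abs ?Lnorm_ge0// unlock -poweRrM (mulrC q^-1%R); apply: (congr1 (poweR^~ _)).
  by apply: eq_integral => p _; rewrite /= ger0_norm.
have [Dy|Dfin] := eqVneq D +oo.
  by rewrite Dy poweRyr ?leey// invr_eq0.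
(* With [s / r = 1 / q], both sides become powers [1 / r] of the quantities in [integral_u_le]. *)
rewrite (_ : D `^ q^-1 = (D `^ s) `^ r^-1); last first.
  by rewrite -poweRrM /s mulrAC divff// mul1r.
apply: gt0_ler_poweR.
- by rewrite invr_ge0 ltW.
- by rewrite in_itv/= leey andbT; apply: integral_ge0 => x _; exact: poweR_ge0.
- by rewrite in_itv/= leey andbT poweR_ge0.
- by apply: integral_u_le; rewrite ltey.
Qed.

End finite_exponents.
End dispersive_estimate.

(** * The dispersive estimate for r = +oo and finite q *)

Section dispersive_estimate_sup.
Local Open Scope ereal_scope.
Context {d : measure_display} {P : measurableType d} {R : realType}.
Local Notation mu := (@lebesgue_measure R).
Local Notation X := (measurableTypeR R).
Variables (tau : {sigma_finite_measure set P -> \bar R}) (v w : P -> R).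
Hypothesis tau_gt0 : 0 < tau [set: P].
Hypothesis mv : measurable_fun setT v.
Hypothesis mw : measurable_fun setT w.
Hypothesis w0 : forall p, (0 <= w p)%R.
Hypothesis w_gt0 : {ae tau, forall p, (0 < w p)%R}.
(** The sign is opposite to the finite case: here [W] is evaluated along the backward flow from a
    fixed point, whereas there a test function is carried forward. *)
Hypothesis flow_le : forall (y : R) (h : X -> \bar R),
  measurable_fun setT h -> (forall x, 0 <= h x) ->
  \int[tau]_p (h (y - v p)%R * (w p)%:E) <= \int[mu]_x h x.
Variable G : X * P -> R.
Hypothesis mG : measurable_fun setT G.
Hypothesis G0 : forall z, (0 <= G z)%R.

(** Almost everywhere [G ^ q <= W ^ q * w]. Following this along the shear and integrating in [p]
    leaves exactly the integral that [flow_le] bounds. *)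
Lemma dispersive_Lnorm_y (q : R) : (1 <= q)%R ->
  Lnorm mu +oo (fun x => Lnorm tau q%:E (fun p => (G (shift_flow v (x, p)))%:E)) <=
  Lnorm mu q%:E (fun y => Lnorm tau +oo (fun p => (G (y, p) * w p `^ (- q^-1))%:E)).
Proof.
move=> q1; have q0 : (0 < q)%R by exact: lt_le_trans q1.
have qN0 : q != 0%R by rewrite gt_eqF.
pose W (y : X) := Lnorm tau +oo (fun p => (G (y, p) * w p `^ (- q^-1))%:E).
have mW : measurable_fun setT W.
  apply: (measurable_inner_Lnorm _ _ (fun z => (G z * w z.2 `^ (- q^-1))%:E)).
    exact: leey.
  apply/measurable_EFinP; apply: measurable_funM => //.
  by apply: measurable_fun_powR; exact: measurableT_comp.
have mWq : measurable_fun setT (fun y => W y `^ q) by exact: measurable_fun_poweR.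
(* The exceptional set of the pointwise bound is formed in the product, so that its nullness can be
   carried through the shear and read off on slices at fixed [x]. *)
pose N : set (X * P) := [set z | W z.1 `^ q * (w z.2)%:E < (G z `^ q)%:E].
have mN : measurable N.
  rewrite -[N]setTI; apply: measurable_lte => //.
    apply: emeasurable_funM; first exact: (measurableT_comp mWq).
    by apply/measurable_EFinP; exact: measurableT_comp.
  by apply/measurable_EFinP; exact: measurable_fun_powR.
have N0 : (mu \x tau) N = 0.
  apply/product_null1P => //; apply: nearW => y.
  apply/(negligible_measure0 tau _ (measurable_slice1 _ y mN)).
  have := ess_sup_ge tau (abse \o (fun p => (G (y, p) * w p `^ (- q^-1))%:E)).
  have -> : ess_sup tau (abse \o (fun p => (G (y, p) * w p `^ (- q^-1))%:E)) = W y.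
    by rewrite /W unlock tau_gt0.
  apply: filterS2 w_gt0 => p wp.
  rewrite /= ger0_norm; last by rewrite mulr_ge0// powR_ge0.
  move=> GW; apply/negP; rewrite -leNgt /=.
  have -> : (G (y, p) `^ q)%:E = (G (y, p) * w p `^ (- q^-1))%:E `^ q * (w p)%:E.
    rewrite poweR_EFin powR_weight// mulNr mulVf// -EFinM -mulrA.
    by rewrite powR_inv1// mulVf ?mulr1// gt_eqF.
  rewrite lee_wpmul2r ?lee_fin// gt0_ler_poweR//; first exact: ltW.
    by rewrite in_itv/= leey andbT lee_fin mulr_ge0// powR_ge0.
  by rewrite in_itv/= leey andbT Lnorm_ge0.
have NS0 : (mu \x tau) (shift_flow v @^-1` N) = 0 by exact/shift_flow_null.
have mNS := measurable_preimage_shift_flow v mv N mN.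
have -> : Lnorm mu q%:E W = (\int[mu]_y (W y `^ q)) `^ q^-1.
  rewrite {1}unlock; apply: (congr1 (poweR^~ _)); apply: eq_integral => y _.
  by rewrite gee0_abs ?Lnorm_ge0.
rewrite {1}unlock lebesgue_measure_setT_gt0; apply/ess_supP.
move/product_null1P : NS0 => /(_ mNS); apply: filterS => x Nx /=.
rewrite gee0_abs ?Lnorm_ge0// unlock gt0_ler_poweR//.
- by rewrite invr_ge0 ltW.
- by rewrite in_itv/= leey andbT integral_ge0// => p _; exact: poweR_ge0.
- by rewrite in_itv/= leey andbT integral_ge0// => p _; exact: poweR_ge0.
apply: le_trans (flow_le x (fun y => W y `^ q) mWq _); last first.
  by move=> y; exact: poweR_ge0.
apply: ge0_ae_le_integral_nomeas.
- by move=> p; exact: poweR_ge0.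
- by move=> p; rewrite mule_ge0 ?poweR_ge0// lee_fin.
have /(negligible_measure0 tau _ (measurable_slice1 _ x mNS)) := Nx.
apply: filterS => p; rewrite /N /= => /negP; rewrite -leNgt.
by rewrite ger0_norm.
Qed.

End dispersive_estimate_sup.

(** * Positive homogeneity of Lebesgue norms *)

Section Lnorm_scale.
Local Open Scope ereal_scope.
Context {d : measure_display} {T : measurableType d} {R : realType}.
Variable m : {measure set T -> \bar R}.

Lemma ge0_LnormZl (q : \bar R) (k : R) (f : T -> \bar R) :
  1 <= q -> (0 < k)%R -> measurable_fun setT f -> (forall x, 0 <= f x) ->
  Lnorm m q (fun x => k%:E * f x) = k%:E * Lnorm m q f.
Proof.
move=> q1 k0 mf f0; have kf0 x : 0 <= k%:E * f x by rewrite mule_ge0// lee_fin ltW.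
rewrite unlock; case: q q1 => [q||]// q1.
- have q0 : (0 < q)%R by rewrite -lte_fin (lt_le_trans _ q1)// lte_fin.
  have -> : \int[m]_x (`|k%:E * f x| `^ q) = (k `^ q)%:E * \int[m]_x (`|f x| `^ q).
    rewrite -ge0_integralZl_EFin ?powR_ge0//; last 2 first.
    - by move=> x _; exact: poweR_ge0.
    - by apply: measurable_fun_poweR; exact: measurableT_comp.
    apply: eq_integral => x _; rewrite !gee0_abs// poweRM// lee_fin; exact: ltW.
  rewrite poweRM ?lee_fin ?powR_ge0//.
    by rewrite poweR_EFin -powRrM divff ?powRr1 ?gt_eqF// ltW.
  by apply: integral_ge0 => x _; exact: poweR_ge0.
- case: ifP => _; last by rewrite mule0.
  rewrite -ess_sup_pZl//; apply: eq_ess_sup; apply: nearW => x /=.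
  by rewrite !gee0_abs.
Qed.

End Lnorm_scale.

(** * Transfer of the estimates to the torus and to the transport group *)

Section transport.
Local Open Scope ereal_scope.
Context {R : realType}.
Local Notation mu := (@lebesgue_measure R).
Local Notation X := (measurableTypeR R).
Local Notation T := (torus_measure R).

Lemma torus_measure_fin_num : fin_num_fun T.
Proof.
move=> A mA; rewrite ge0_fin_numE//; apply: (@le_lt_trans _ _ (T setT)).
  by apply: le_measure; rewrite ?inE.
by rewrite torus_measure_setT ltry.
Qed.

(** The same measure, packed with its finiteness to serve where a sigma-finite measure is
    required. *)
Definition finite_torus_measure : {finite_measure set X -> \bar R} :=
  HB.pack (Measure.sort T) (Measure_isFinite.Build _ _ _ T torus_measure_fin_num).

Local Notation tau := finite_torus_measure.

(* Instance search for [Filter] does not see through [torus_measure]. *)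
Let ae_torusS (P Q : X -> Prop) :
  (forall p, P p -> Q p) -> {ae T, forall p, P p} -> {ae T, forall p, Q p}.
Proof. by apply: filterS; exact: (ae_filter_ringOfSetsType T). Qed.

Let ae_torus_and (P Q : X -> Prop) : {ae T, forall p, P p} ->
  {ae T, forall p, Q p} -> {ae T, forall p, P p /\ Q p}.
Proof. by move=> aP aQ; apply: (@filterI _ _ (ae_filter_ringOfSetsType T)). Qed.

Lemma measurable_normc {d : measure_display} {Y : measurableType d} (g : Y -> R[i]) :
  measurable_fun setT (fun z => complex.Re (g z)) ->
  measurable_fun setT (fun z => complex.Im (g z)) ->
  measurable_fun setT (fun z => Normc.normc (g z)).
Proof.
move=> mRe mIm.
rewrite (_ : (fun z => Normc.normc (g z)) =
    (fun z => Num.sqrt (complex.Re (g z) ^+ 2 + complex.Im (g z) ^+ 2)%R)); last first.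
  by apply/funext => z; case: (g z).
apply: (@measurableT_comp _ _ _ _ _ _ (@Num.sqrt R)).
  by apply: continuous_measurable_fun; exact: sqrt_continuous.
by apply: measurable_funD; exact: measurable_funX.
Qed.

Lemma normc_real (c : R) : Normc.normc c%:C = `|c|%R.
Proof. by rewrite /Normc.normc /= expr0n addr0 sqrtr_sqr. Qed.

Lemma measurable_flow (t : R) :
  measurable_fun setT (fun p : X => branch_velocity p * t)%R.
Proof.
apply: measurable_funM => //.
by apply: continuous_measurable_fun; exact: continuous_branch_velocity.
Qed.

Lemma measurable_omega : measurable_fun setT (@omega R : X -> R).
Proof.
apply: measurableT_comp => //.
by apply: continuous_measurable_fun; exact: continuous_sin_half.
Qed.

Lemma product_torus_null (N : set (X * X)) : measurable N ->
  (mu \x mu) N = 0 -> (mu \x tau) N = 0.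
Proof.
move=> mN /(product_null1P mu mu _ mN) h; apply/product_null1P => //.
apply: filterS h => x Nx; apply/eqP; rewrite -measure_le0 -Nx.
by apply: torus_measure_le; exact: measurable_slice1.
Qed.

(** The shear pulls the exceptional set back to a null set, whose slices are null for almost every
    [x]. Thus an almost everywhere identity survives evaluation along the flow. *)
Lemma ae_flow_torus (t : R) (P : X * X -> Prop) :
  {ae (mu \x mu), forall z, P z} ->
  {ae mu, forall x, {ae T, forall p, P (shift_flow (fun p => branch_velocity p * t)%R (x, p))}}.
Proof.
move=> [N [mN N0 PN]].
have mv := measurable_flow t.
have := product_torus_null _ mN N0.
move/(shift_flow_null tau _ mv _ mN).
have mNS := measurable_preimage_shift_flow _ mv _ mN.
move/(product_null1P mu tau _ mNS); apply: filterS => x.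
move/(negligible_measure0 tau _ (measurable_slice1 _ x mNS)).
by apply: ae_torusS => p nN; apply: contrapT => nP; apply: nN; exact: PN nP.
Qed.

Lemma ae_torus_slices (P : X * X -> Prop) :
  {ae (mu \x mu), forall z, P z} -> {ae mu, forall x, {ae T, forall p, P (x, p)}}.
Proof.
move=> /(ae_flow_torus 0); apply: filterS => x; apply: ae_torusS => p.
by rewrite /shift_flow /= mulr0 subr0.
Qed.

(** * Mixed norms expressed through a Borel version of the modulus *)

Section borel_representative.
Variables (f : R -> R -> R[i]) (G : X * X -> R).
Hypothesis fG : {ae (mu \x mu), forall z, Normc.normc (f z.1 z.2) = G z}.

Lemma mixed_norm_borel (r q : \bar R) :
  mixed_norm r q f = Lnorm mu r (fun x => Lnorm tau q (fun p => (G (x, p))%:E)).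
Proof.
apply: ae_eq_Lnorm_Lnorm; apply: filterS (ae_torus_slices _ fG) => x.
by apply: ae_torusS => p /= ->.
Qed.

Lemma mixed_norm_transport_borel (t : R) (r q : \bar R) :
  mixed_norm r q (transport t f) = Lnorm mu r (fun x => Lnorm tau q
    (fun p => (G (shift_flow (fun p => branch_velocity p * t)%R (x, p)))%:E)).
Proof.
apply: ae_eq_Lnorm_Lnorm; apply: filterS (ae_flow_torus t _ fG) => x.
move=> fE; have := ae_torus_and _ _ (ae_torus _ velocityE) fE.
by apply: ae_torusS => p /= [vE <-]; rewrite /transport vE.
Qed.

Lemma weighted_mixed_norm_borel (W : R -> R) (r q : \bar R) :
  (forall p, 0 <= W p)%R ->
  weighted_mixed_norm r q W f =
  Lnorm mu r (fun x => Lnorm tau q (fun p => (G (x, p) * W p)%:E)).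
Proof.
move=> W0; apply: ae_eq_Lnorm_Lnorm; apply: filterS (ae_torus_slices _ fG) => x.
by apply: ae_torusS => p /= fE; rewrite Normc.normcM normc_real ger0_norm// fE.
Qed.

End borel_representative.

(* The weight that makes the change of variables an inequality with constant 1
   is |t / 4| * omega; its power of |t / 4| is then factored out. *)
Lemma mixed_norm_weight_factor (t a : R) (q r : \bar R) (G : X * X -> R) :
  1 <= q -> 1 <= r -> (t != 0)%R ->
  measurable_fun setT G -> (forall z, 0 <= G z)%R ->
  Lnorm mu q (fun y => Lnorm tau r
    (fun p => (G (y, p) * (`|t / 4| * omega p) `^ a)%:E)) =
  (`|t / 4| `^ a)%:E * Lnorm mu q (fun y => Lnorm tau r
    (fun p => (G (y, p) * omega p `^ a)%:E)).
Proof.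
move=> q1 r1 t0 mG G0.
have k0 : (0 < `|t / 4| `^ a)%R by rewrite powR_gt0// normr_gt0 mulf_neq0.
have mGw : measurable_fun setT (fun z : X * X => (G z * omega z.2 `^ a)%:E).
  apply/measurable_EFinP; apply: measurable_funM => //.
  apply: measurable_fun_powR.
  exact: (measurableT_comp measurable_omega).
rewrite -ge0_LnormZl//; last 2 first.
- exact: (measurable_inner_Lnorm tau r _ r1 mGw).
- by move=> y; exact: Lnorm_ge0.
congr (Lnorm mu q _); apply/funext => y.
rewrite -ge0_LnormZl//; last 2 first.
- exact: (measurable_pair_slice _ y mGw).
- by move=> p; rewrite lee_fin mulr_ge0// powR_ge0.
congr (Lnorm tau r _); apply/funext => p.
by rewrite -EFinM powRM ?omega_ge0// mulrCA.
Qed.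

Lemma exponent_gap_fin (q r : R) : (1 <= q)%R -> (1 <= r)%R ->
  exponent_gap q%:E r%:E = (q^-1 - r^-1)%R.
Proof.
move=> q1 r1; rewrite /exponent_gap !inver.
by rewrite !gt_eqF// (lt_le_trans ltr01).
Qed.

Lemma exponent_gap_y (q : R) : (1 <= q)%R -> exponent_gap q%:E +oo = q^-1%R.
Proof.
move=> q1; rewrite /exponent_gap inver invey.
by rewrite gt_eqF ?(lt_le_trans ltr01)//= oppr0 addr0.
Qed.

Lemma exponent_gapxx (q : \bar R) : 1 <= q -> exponent_gap q q = 0%R.
Proof.
case: q => [q| |]// q1; first by rewrite exponent_gap_fin// subrr.
by rewrite /exponent_gap invey sube0.
Qed.

Lemma dispersive_torus (t : R) (q r : \bar R) (G : X * X -> R) :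
  (t != 0)%R -> 1 <= q -> q < r -> measurable_fun setT G -> (forall z, 0 <= G z)%R ->
  Lnorm mu r (fun x => Lnorm tau q
    (fun p => (G (shift_flow (fun p => branch_velocity p * t)%R (x, p)))%:E)) <=
  Lnorm mu q (fun y => Lnorm tau r
    (fun p => (G (y, p) * (`|t / 4| * omega p) `^ (- exponent_gap q r))%:E)).
Proof.
move=> t0 q1 qr mG G0.
have mv := measurable_flow t.
have mw : measurable_fun setT (fun p : X => `|t / 4| * omega p)%R.
  by apply: measurable_funM => //; exact: measurable_omega.
have w0 (p : X) : (0 <= `|t / 4| * omega p)%R by rewrite mulr_ge0 ?omega_ge0.
have w_gt0 : {ae tau, forall p, (0 < `|t / 4| * omega p)%R}.
  apply: ae_torus => p p02; rewrite mulr_gt0 ?normr_gt0 ?mulf_neq0//.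
  by rewrite gt_eqF// sin_half_gt0.
case: q q1 qr => [q| |]// q1 qr; last by rewrite ltNge leey in qr.
case: r qr => [r| |]// qr.
  rewrite exponent_gap_fin//; last by rewrite -lee_fin (le_trans q1)// ltW.
  apply: dispersive_Lnorm_fin => // y h mh h0.
  exact: flow_change_of_variables_le.
rewrite exponent_gap_y//; apply: dispersive_Lnorm_y => //.
  by rewrite torus_measure_setT lte_fin mulr_gt0// pi_gt0.
move=> y h mh h0.
(* Reversing time matches the backward flow and leaves the weight unchanged, as it contains
   [|t / 4|]. *)
have := flow_change_of_variables_le (- t)%R y h mh h0.
by rewrite mulNr normrN; under eq_integral do rewrite mulrN.
Qed.

End transport.

Theorem lemma3p3 (R : realType) (f : R -> R -> R[i])
    (f_periodic : periodic2 f) (f_measurable : lebesgue_measurable2 f) :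
  (forall q r : \bar R, (1 <= q)%E -> (q <= r)%E ->
     forall t : R, t != 0 ->
       (mixed_norm r q (transport t f) <=
        (`|t / 4| `^ (- exponent_gap q r))%R%:E *
        weighted_mixed_norm q r
          (fun p => (omega p `^ (- exponent_gap q r))%R) f)%E) /\
  (forall q r : \bar R, (1 <= q)%E -> q = r ->
     forall t : R, mixed_norm r q (transport t f) = mixed_norm q r f).
Proof.
have [g [mRe mIm fg]] := f_measurable.
pose G z := Normc.normc (g z).
have mG : measurable_fun setT G by exact: measurable_normc.
have G0 z : 0 <= G z by rewrite /G; case: (g z) => a b; exact: sqrtr_ge0.
have fG : {ae (@lebesgue_measure R \x @lebesgue_measure R)%E,
    forall z, Normc.normc (f z.1 z.2) = G z}.
  have [N [mN N0 sN]] := fg; exists N; split=> // z nfz; apply: sN => fz.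
  exact: (nfz (congr1 (@Normc.normc R) fz)).
(* Serves both the second claim and the case [q = r] of the first. *)
have diag (q : \bar R) (t : R) : (1 <= q)%E ->
    mixed_norm q q (transport t f) = mixed_norm q q f.
  move=> q1; rewrite (mixed_norm_transport_borel _ _ fG) (mixed_norm_borel _ _ fG).
  apply: (shift_flow_Lnorm_diag _ _ (measurable_flow t) q (EFin \o G)) => //.
  - by rewrite torus_measure_setT lte_fin mulr_gt0// pi_gt0.
  - exact/measurable_EFinP.
split=> [q r q1 qr t t0|q r q1 <- t]; last exact: diag.
have [<-|qNr] := eqVneq q r.
  (* With exponent 0 the constant and the weight are both 1, even at zeros of [omega], since
     [0 ^ 0 = 1] for this power. *)
  rewrite exponent_gapxx// oppr0 powRr0 mul1e diag//.
  rewrite /weighted_mixed_norm (_ : (fun x p => _) = f)//.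
  by apply/funext => x; apply/funext => p; rewrite powRr0 mulr1.
have {qNr}qr : (q < r)%E by rewrite lt_neqAle qNr.
rewrite (mixed_norm_transport_borel _ _ fG) (weighted_mixed_norm_borel _ _ fG); last first.
  by move=> p; exact: powR_ge0.
rewrite -mixed_norm_weight_factor//; last exact: le_trans (ltW qr).
exact: dispersive_torus.
Qed.
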